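(* Let $\mu$ be a tempered probability measure on $(\mathcal C,\mathcal F^{\mathcal C})$ such that the loop property holds at any scale and $\mathbb E[V^2]<\infty$, where $V=\sup_{s\in[0,1]}\|h(s)\|$ and $h$ has distribution $\mu$. Let $\overline\xi$ be a Poisson point process on $\mathbb R^2\times\mathcal C$ with intensity $\mathrm dx\otimes\mu$, let $\rho=100$ and let $V_0>0$ be fixed, large enough as specified in the context. Then, with probability $1$, for any $n$ large enough, $T_n\ge(4/3)^n$.
   Context: $B(c,r)$ is the closed Euclidean ball of $\mathbb R^2$, $B(r)=B(0,r)$, $\mathring B$ the open ball. $\mathcal C$ is the space of continuous $h:\mathbb R_+\to\mathbb R^2$ with $h(0)=0$, with product $\sigma$-algebra $\mathcal F^{\mathcal C}$. A configuration is a finite or countable $\overline S=\{(x,h_x):x\in S\}\subset\mathbb R^2\times\mathcal C$ with one-to-one projection $S$ to $\mathbb R^2$; $g_x(t)=x+h_x(t)$, $G_x(t)=g_x([0,t])$; $\overline S_{|B}=\overline S\cap(B\times\mathcal C)$; $\overline S-u=\{(x-u,h):(x,h)\in\overline S\}$. $\overline{\mathcal S}$ is the set of configurations with the $\sigma$-field $\mathcal F^{\overline{\mathcal S}}$ generated by counting maps. $\xi$ is the projection of $\overline\xi$. Lifetime functions: for $\tau:S\to(0,\infty]$, $x\neq y$, $t_x\ge0$: $x$ $\tau$-hits $y$ at time $t_x$ if there is $t_y\ge0$ with $t_x\le\tau(x)$, $t_y\le\tau(y)$, $g_x(t_x)=g_y(t_y)$, $t_y\le t_x$. $\tau$ is a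 lifetime function of $\overline S$ if a $\tau$-hit of some $y\ne x$ by $x$ at time $t_x$ implies $\tau(x)=t_x$, and $\tau(x)<\infty$ implies that $x$ $\tau$-hits some $y\ne x$ at time $\tau(x)$. $\overline S$ is tempered if it has a unique lifetime function $\tau(\cdot;\overline S)$; finite configurations are tempered; ''$x$ is stopped by $y$'' means $x$ $\tau$-hits $y$. $\mu$ is tempered if $\overline\xi$ belongs a.s. to a measurable translation-invariant set of tempered configurations on which $\overline S\mapsto\{(x,\tau(x;\overline S)):x\in S\}$ is measurable (for the $\sigma$-fields generated by counting maps). Loop property at scale $\alpha>0$: there exist $\mathcal L(\alpha)\in\mathcal F^{\overline{\mathcal S}}$ and $r(\alpha)\in(0,\alpha)$ with: (1) $\mathbb P[\overline\xi\in\mathcal L(\alpha)]>0$; (2) $\overline S\in\mathcal L(\alpha)\iff\overline S_{|B(\alpha)}\in\mathcal L(\alpha)$ for all $\overline S$; (3) on $\{\overline\xi\in\mathcal L(\alpha)\}$, $\xi\cap B(\alpha)=\{x_1,\dots,x_n\}$ with $n\ge2$ and, in the model associated with $\overline\xi_{|B(\alpha)}$: $x_i$ is stopped by $x_{i+1}$ ($1\le i\le n-1$) and $x_n$ by $x_1$; all lifetimes are $\le\alpha$; and $\bigcup_iG_{x_i}(\tau(x_i;\overline\xi_{|B(\alpha)}))$ is included in $\mathring B(\alpha)\setminus B(r(\alpha))$ and separates $B(r(\alpha))$ from $\mathbb R^2\setminus\mathring B(\alpha)$. The pair $\mathcal L(1),r(1)$ is fixed. Speeds. For $x\in\xi$,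 $V(x)=\sup_{s\in[0,1]}\|h_x(s)\|$, $V^+(x)=V(x)+1$; $V^+=V+1$ with law $\mathbb P_{V^+}$; $V_0^+=V_0+1$. There is a local low-speed obstacle around $c$ if $\overline\xi^{<V_0}-c\in\mathcal L(1)$, where $\overline\xi^{<V_0}=\{(x,h_x)\in\overline\xi:V(x)<V_0\}$, and for all $x\in\xi\setminus B(c,1)$ with $V(x)<V_0$, $G_x(1)\cap B(c,1)=\emptyset$. Constants. $\rho=100$. Finite sets $L_i\subset\partial B(20i)$, $i=1,2,3$, are fixed with $\partial B(20i)\subset\bigcup_{w\in L_i}B(w,\rho^{-1})$, and $C=\max\big(\#L_1\#L_2+\#L_1\#L_3+\#L_2\#L_3,\ \pi(1+\rho^2)^2\big)$. $V_0$ is fixed large enough that $\mathbb P[\text{local low-speed obstacle around }0]>0$ and that there is an integer $n_0$ with $\rho^{n_0-1}<V_0^+$, $6V_0^+<\rho^{n_0-1}(\rho-1)$ and $C^2\int_{(\rho^{n_0-2},+\infty)}(v^+)^2\,\mathrm d\mathbb P_{V^+}(v^+)\le\frac14$. Pollution. $\Sigma=\bigcup_{x\in\xi:V(x)\ge V_0}B(x,V^+(x))$. For $n\ge1$, $A_n=B(\rho^n)\setminus\mathring B(\rho^{n-1})$. A continuous path crosses $A_n$ if it starts on the inner boundary of $A_n$, ends on its outer boundary and remains in $A_n$ in the meantime. A set $W\subset A_n$ is separated if any two distinct points of $W$ are at distance at least $3V_0^+$ from each other and each point of $W$ is at distance at least $3V_0^+$ from the boundaries of $A_n$. For a path $\pi$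 crossing $A_n$, $S_n(\pi)=\max\{\#W:W\subset\pi,\ W\subset\Sigma^c,\ W\text{ is separated}\}$, and $T_n=\inf_{\pi\text{ crosses }A_n}S_n(\pi)$. *)

(* Defs.v *)
From HB Require Import structures.
From mathcomp Require Import all_boot all_order all_algebra finmap.
From mathcomp Require Import all_classical all_reals all_analysis.
From mathcomp Require Import measurable_realfun.

Set Implicit Arguments.
Unset Strict Implicit.
Unset Printing Implicit Defensive.

Import Order.TTheory GRing.Theory Num.Theory.
Import numFieldNormedType.Exports.

Local Open Scope classical_set_scope.
Local Open Scope ring_scope.

(* The norm that MathComp-Analysis puts on products is the sup norm, so the
   Euclidean norm is defined by hand.  It induces the same topology. *)
Notation plane R := (R * R)%type.

Section Plane.
Variable R : realType.

Definition enorm (x : plane R) : R := Num.sqrt (x.1 ^+ 2 + x.2 ^+ 2).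

Definition disk (c : plane R) (r : R) : set (plane R) :=
  [set x | enorm (x - c) <= r].

Definition open_disk (c : plane R) (r : R) : set (plane R) :=
  [set x | enorm (x - c) < r].

Definition circle (c : plane R) (r : R) : set (plane R) :=
  [set x | enorm (x - c) = r].

Definition separates (K A B : set (plane R)) :=
  forall gamma : R -> plane R, {within `[0, 1], continuous gamma} ->
    A (gamma 0) -> B (gamma 1) -> exists2 t, t \in `[0, 1] & K (gamma t).

End Plane.

(* A continuous map h : [0, oo) -> R^2 with h 0 = 0 is encoded by its extension
   to the whole line by 0, which is continuous because h 0 = 0.  This makes
   [trajectory] a bijective copy of the space of such maps. *)
Record trajectory (R : realType) := Trajectory {
  trajectory_fun :> R -> plane R ;
  trajectory_continuous : continuous trajectory_fun ;
  trajectory_le0 : forall t, t <= 0 -> trajectory_fun t = 0 }.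

Lemma trajectory0_subproof (R : realType) : continuous ((fun=> 0) : R -> plane R).
Proof. by move=> t; exact: cvg_cst. Qed.

Definition trajectory0 (R : realType) : trajectory R :=
  @Trajectory R (fun=> 0) (@trajectory0_subproof R) (fun _ _ => erefl).

HB.instance Definition _ (R : realType) := gen_eqMixin (trajectory R).
HB.instance Definition _ (R : realType) := gen_choiceMixin (trajectory R).
HB.instance Definition _ (R : realType) :=
  isPointed.Build (trajectory R) (trajectory0 R).

Definition trajectory_cylinders (R : realType) : set_system (trajectory R) :=
  [set [set h : trajectory R | A (h t)] |
    t in [set: R] & A in [set A : set (plane R) | measurable A]].

HB.instance Definition _ (R : realType) :=
  Measurable.copy (trajectory R)
    (g_sigma_algebraType (@trajectory_cylinders R)).

Notation mark R := (plane R * trajectory R)%type.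

Record config (R : realType) := Config {
  atoms : set (mark R) ;
  atoms_countable : countable atoms ;
  atoms_inj : forall p q, atoms p -> atoms q -> p.1 = q.1 -> p = q }.

Definition config0 (R : realType) : config R :=
  @Config R set0 (@countable0 _) (fun _ _ h => False_ind _ h).

HB.instance Definition _ (R : realType) := gen_eqMixin (config R).
HB.instance Definition _ (R : realType) := gen_choiceMixin (config R).
HB.instance Definition _ (R : realType) :=
  isPointed.Build (config R) (config0 R).

Definition atom_count (R : realType) (A : set (mark R)) (S : config R) : \bar R :=
  counting (atoms S `&` A).

Definition atom_count_preimages (R : realType) : set_system (config R) :=
  [set atom_count A @^-1` B |
    A in [set A : set (mark R) | measurable A] &
    B in [set B : set (\bar R) | measurable B]].

HB.instance Definition _ (R : realType) :=
  Measurable.copy (config R) (g_sigma_algebraType (@atom_count_preimages R)).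

Section Configurations.
Variable R : realType.
Implicit Types (S : config R) (p q : mark R) (tau : plane R -> \bar R).

Lemma restriction_countable S (D : set (mark R)) : countable (atoms S `&` D).
Proof.
by apply: (sub_countable (subset_card_le _) (atoms_countable S)) => p []. Qed.

Lemma restriction_inj S (D : set (mark R)) p q :
  (atoms S `&` D) p -> (atoms S `&` D) q -> p.1 = q.1 -> p = q.
Proof. by move=> [Sp _] [Sq _] e; exact: (atoms_inj Sp Sq e). Qed.

Definition restriction S (D : set (mark R)) : config R :=
  Config (restriction_countable S D) (@restriction_inj S D).

Definition restrict_to S (B : set (plane R)) : config R :=
  restriction S [set p | B p.1].

Lemma translate_countable S (u : plane R) :
  countable ((fun p : mark R => (p.1 - u, p.2)) @` atoms S).
Proof. exact: (sub_countable (card_image_le _ _) (atoms_countable S)). Qed.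

Lemma translate_inj S (u : plane R) p q :
  ((fun p : mark R => (p.1 - u, p.2)) @` atoms S) p ->
  ((fun p : mark R => (p.1 - u, p.2)) @` atoms S) q -> p.1 = q.1 -> p = q.
Proof.
by move=> [p' Sp <-] [q' Sq <-] /= /addIr e; rewrite (atoms_inj Sp Sq e).
Qed.

Definition translate S (u : plane R) : config R :=
  Config (translate_countable S u) (@translate_inj S u).

Definition position p (t : R) : plane R := p.1 + p.2 t.

Definition swept p (t : \bar R) : set (plane R) :=
  [set position p s | s in [set s : R | 0 <= s /\ (s%:E <= t)%E]].

(* Lifetimes are functions of the whole plane of which only the values at the
   points of the configuration matter. *)
Definition hits tau p q (t : R) : Prop :=
  [/\ 0 <= t, (t%:E <= tau p.1)%E &
    exists u : R, [/\ 0 <= u, (u%:E <= tau q.1)%E,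
      position p t = position q u & u <= t]].

Definition is_lifetime S tau : Prop :=
  [/\ forall p, atoms S p -> (0 < tau p.1)%E,
      forall p q t, atoms S p -> atoms S q -> p.1 <> q.1 ->
        hits tau p q t -> tau p.1 = t%:E &
      forall p, atoms S p -> (tau p.1 < +oo)%E ->
        exists q t, [/\ atoms S q, p.1 <> q.1, tau p.1 = t%:E &
          hits tau p q t]].

Definition tempered_config S : Prop :=
  exists2 tau, is_lifetime S tau &
    forall tau', is_lifetime S tau' ->
      forall p, atoms S p -> tau' p.1 = tau p.1.

(* Meaningful at the points of S when S is tempered. *)
Definition lifetime S : plane R -> \bar R :=
  xget (cst +oo%E) [set tau | is_lifetime S tau].

Definition stopped_by S p q : Prop := exists t, hits (lifetime S) p q t.

Definition lifetime_graph S : set (plane R * \bar R) :=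
  [set (p.1, lifetime S p.1) | p in atoms S].

Definition loop_config (alpha r : R) S : Prop :=
  exists (n : nat) (x : 'I_n -> mark R),
    let loop := \bigcup_i swept (x i) (lifetime S (x i).1) in
    [/\ (1 < n)%N, injective x & range x = atoms S] /\
    [/\ forall i, stopped_by S (x i) (x (ordS i)),
        forall i, (lifetime S (x i).1 <= alpha%:E)%E,
        loop `<=` open_disk 0 alpha `\` disk 0 r &
        separates loop (disk 0 r) (~` open_disk 0 alpha)].

Definition speed (h : trajectory R) : R :=
  sup [set enorm (h s) | s in `[0, 1]].

Definition speed_plus (h : trajectory R) : R := speed h + 1.

Definition slow S (V0 : R) : config R := restriction S [set p | speed p.2 < V0].

Definition low_speed_obstacle (L1 : set (config R)) (V0 : R) (c : plane R) S :
    Prop :=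
  L1 (translate (slow S V0) c) /\
  forall p, atoms S p -> ~ disk c 1 p.1 -> speed p.2 < V0 ->
    swept p 1%:E `&` disk c 1 = set0.

End Configurations.

Section Processes.
Variables (R : realType) (d : measure_display) (Omega : measurableType d).
Variable P : probability Omega R.
Local Open Scope ereal_scope.

(* The second argument of [poisson_prob] is a dummy.  Counts being valued in
   the countable set {0, 1, ..., +oo}, independence is the product rule for
   point events. *)
Definition poisson_process (Lambda : set (mark R) -> \bar R)
    (xi : {RV P >-> config R}) : Prop :=
  [/\ forall (A : set (mark R)) (k : nat), measurable A -> Lambda A < +oo ->
        P [set w | atom_count A (xi w) = k%:R%:E] =
          poisson_prob (fine (Lambda A)) 0%N [set k],
      forall A : set (mark R), measurable A -> Lambda A = +oo ->
        P [set w | atom_count A (xi w) = +oo] = 1 &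
      forall (m : nat) (A : 'I_m -> set (mark R)) (k : 'I_m -> \bar R),
        (forall i, measurable (A i)) -> trivIset setT A ->
        P (\bigcap_i [set w | atom_count (A i) (xi w) = k i]) =
          \prod_(i < m) P [set w | atom_count (A i) (xi w) = k i]].

(* A map into a space of point configurations is measurable for the
   sigma-field generated by the counting maps iff its composition with each of
   them is measurable. *)
Definition tempered (xi : {RV P >-> config R}) : Prop :=
  exists T : set (config R),
    [/\ measurable T, T `<=` @tempered_config R,
        forall S u, T S -> T (translate S u),
        forall B : set (plane R * \bar R), measurable B ->
          measurable_fun T
            (fun S => counting (lifetime_graph S `&` B) : \bar R) &
        {ae P, forall w, T (xi w)}].

Definition loop_witness (xi : {RV P >-> config R}) (alpha : R)
    (L : set (config R)) (r : R) : Prop :=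
  [/\ measurable L, (0 < r < alpha)%R, 0 < P [set w | L (xi w)],
      forall S, L S <-> L (restrict_to S (disk 0%R alpha)) &
      forall w, L (xi w) ->
        loop_config alpha r (restrict_to (xi w) (disk 0%R alpha))].

Definition loop_property (xi : {RV P >-> config R}) (alpha : R) : Prop :=
  exists L r, loop_witness xi alpha L r.

End Processes.

Section Pollution.
Variable R : realType.

Definition rho : R := 100.

Definition circle_net (i : nat) (L : {fset plane R}) : Prop :=
  [set` L] `<=` circle 0 (20 * i%:R) /\
  circle 0 (20 * i%:R) `<=` \bigcup_(w in [set` L]) disk w rho^-1.

Definition net_constant (N1 N2 N3 : {fset plane R}) : R :=
  Num.max (#|` N1| * #|` N2| + #|` N1| * #|` N3| + #|` N2| * #|` N3|)%:R
          (pi * (1 + rho ^+ 2) ^+ 2).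

(* The exponents n0 - 1 and n0 - 2 are integers and may be negative. *)
Definition speed_threshold (mu : probability (trajectory R) R) (C V0 : R) :
    Prop :=
  exists n0 : int,
    [/\ rho ^ (n0 - 1) < V0 + 1,
        6 * (V0 + 1) < rho ^ (n0 - 1) * (rho - 1) &
        ((C ^+ 2)%:E *
          \int[pushforward mu (@speed_plus R)]_(v in `]rho ^ (n0 - 2), +oo[)
            (v ^+ 2)%:E <= (1 / 4)%:E)%E].

Definition pollution (V0 : R) (S : config R) : set (plane R) :=
  \bigcup_(p in [set p | atoms S p /\ V0 <= speed p.2])
    disk p.1 (speed_plus p.2).

Definition annulus (n : nat) : set (plane R) :=
  disk 0 (rho ^+ n) `\` open_disk 0 (rho ^+ n.-1).

Definition crosses (n : nat) (gamma : R -> plane R) : Prop :=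
  [/\ {within `[0, 1], continuous gamma},
      circle 0 (rho ^+ n.-1) (gamma 0), circle 0 (rho ^+ n) (gamma 1) &
      gamma @` `[0, 1] `<=` annulus n].

Definition separated_points (V0 : R) (n : nat) (W : set (plane R)) : Prop :=
  [/\ W `<=` annulus n,
      forall x y, W x -> W y -> x <> y -> 3 * (V0 + 1) <= enorm (x - y) &
      forall x z, W x -> (circle 0 (rho ^+ n.-1) `|` circle 0 (rho ^+ n)) z ->
        3 * (V0 + 1) <= enorm (x - z)].

Definition clean_count (V0 : R) (S : config R) (n : nat)
    (gamma : R -> plane R) : \bar R :=
  ereal_sup [set counting W | W in [set W : set (plane R) |
    [/\ W `<=` gamma @` `[0, 1], W `<=` ~` pollution V0 S &
        separated_points V0 n W]]].

Definition min_clean_count (V0 : R) (S : config R) (n : nat) : \bar R :=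
  ereal_inf [set clean_count V0 S n gamma | gamma in [set g | crosses n g]].

End Pollution.

(* Main.v *)
Require Import Defs.
From HB Require Import structures.
From mathcomp Require Import all_boot all_order all_algebra finmap.
From mathcomp Require Import all_classical all_reals all_analysis.
From mathcomp Require Import measurable_realfun.
From mathcomp Require Import ring lra zify.

Set Implicit Arguments.
Unset Strict Implicit.
Unset Printing Implicit Defensive.

Import Order.TTheory GRing.Theory Num.Theory.
Import numFieldNormedType.Exports.

Local Open Scope classical_set_scope.
Local Open Scope ring_scope.

(** The proof is a renormalisation across the scales [rad r0 m], with ratio 100
    and [r0] the [k0]-th power of [rho]; the annulus of index [k0 + m + 1] has
    radii [rad r0 m] and [rad r0 m.+1].

    A path that crosses such an annulus at scale [m + 1] meets three concentric
    circles, of radii 20, 40 and 60 times the inner radius.  On each of them it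
    comes close to a point of a finite net, and from there it has to leave a
    disk of the previous scale, that is, to cross a translated annulus of scale
    [m].  The three translated annuli are far apart, so if at most one of them
    fails to provide enough clean points, the other two double the number of
    clean points found at scale [m].  At scale 0 one point suffices, because
    polluting disks have radius more than [r0] and only disks of radius at most
    [rad r0 m] are counted at scale [m].

    Failure at scale [m + 1] therefore requires either an atom with a large disk
    (more than [rad r0 m]) in the neighbourhood, or failure at scale [m] at two
    net points of different circles.  This recursion is taken as the definition
    of the event [bad], which is measurable because finitely many counts decide
    it, whereas an infimum over paths might not be; [clean_crossing_all] is the
    deterministic statement that off [bad] every crossing has [2 ^ m] clean
    points.

    At net points of different circles, [bad] depends on atoms in disjoint
    boxes, and the two events are independent ([empty_sigma_indep]): both belong
    to sigma-algebras generated by the events that a region contains no atom,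
    which are stable under intersection.  Hence the probability of failure
    satisfies [p (m + 1) <= C * p m ^ 2 + f m], with [f m] an upper bound for
    the expected number of large disks ([prob_bad_le]).  The choice of [V0] gives
    [C * f m <= 1 / 4], so [C * p m] stays below [1 / 2] and the [p m] are
    summable as soon as the [f m] are ([bad_bound_sum]); the latter follows from
    the second moment of the speed ([tail_moment_summable]).

    The second moment also makes summable the probabilities that a disk of
    radius more than [rad r0 m] has its centre within [2 * rad r0 m.+1] of the
    origin.  By the Borel-Cantelli lemma, for large [m] neither this nor [bad]
    occurs at scale [m] around the origin; then no disk of radius more than
    [rad r0 m] reaches the annulus, and counting only small disks loses nothing
    ([min_clean_count_ge]).  The rate [4 / 3] is reached because
    [(4 / 3) ^ (k0 + m + 1) <= 2 ^ m] for [m > k0]. *)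

(** * Euclidean geometry of the plane *)

Section EuclideanNorm.
Variable R : realType.
Implicit Types x y z w : plane R.

Lemma enorm_ge0 x : 0 <= enorm x.
Proof. exact: sqrtr_ge0. Qed.

Lemma sqr_enorm x : enorm x ^+ 2 = x.1 ^+ 2 + x.2 ^+ 2.
Proof. by rewrite sqr_sqrtr // addr_ge0 // sqr_ge0. Qed.

Lemma enormN x : enorm (- x) = enorm x.
Proof. by rewrite /enorm /= !sqrrN. Qed.

Lemma enorm_distC x y : enorm (x - y) = enorm (y - x).
Proof. by rewrite -enormN opprB. Qed.

Lemma enorm0 : enorm (0 : plane R) = 0.
Proof. by rewrite /enorm /= expr0n /= addr0 sqrtr0. Qed.

Lemma enorm_scale (c : R) x : 0 <= c -> enorm (c *: x) = c * enorm x.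
Proof.
move=> c0; rewrite /enorm /= !exprMn -mulrDr sqrtrM ?sqr_ge0 //.
by rewrite sqrtr_sqr ger0_norm.
Qed.

Lemma norm_fst_le_enorm x : `|x.1| <= enorm x.
Proof.
by rewrite -sqrtr_sqr ler_wsqrtr // lerDl sqr_ge0.
Qed.

Lemma norm_snd_le_enorm x : `|x.2| <= enorm x.
Proof.
by rewrite -sqrtr_sqr ler_wsqrtr // lerDr sqr_ge0.
Qed.

Lemma ler_enormD x y : enorm (x + y) <= enorm x + enorm y.
Proof.
have xy0 : 0 <= enorm x + enorm y by rewrite addr_ge0 // enorm_ge0.
rewrite -(ger0_norm xy0) -sqrtr_sqr ler_wsqrtr //.
rewrite (sqrrD (enorm x)) !sqr_enorm /=.
have /(le_trans (ler_norm _)) : `|x.1 * y.1 + x.2 * y.2| <= enorm x * enorm y.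
  rewrite -(@ler_pXn2r _ 2) ?nnegrE ?mulr_ge0 ?enorm_ge0 //.
  rewrite real_normK ?num_real // exprMn !sqr_enorm.
  have := sqr_ge0 (x.1 * y.2 - x.2 * y.1); nra.
nra.
Qed.

Lemma ler_enorm_dist x y z : enorm (x - z) <= enorm (x - y) + enorm (y - z).
Proof. by rewrite (le_trans _ (ler_enormD _ _)) // subrKA. Qed.

Lemma enorm_continuous : continuous (@enorm R).
Proof.
move=> x; apply: (@continuous_comp _ _ _
  (fun y : plane R => y.1 ^+ 2 + y.2 ^+ 2) (@Num.sqrt R));
  last exact: sqrt_continuous.
by apply: cvgD; rewrite !expr2; apply: cvgM;
  (exact: cvg_fst || exact: cvg_snd).
Qed.

(** The intermediate value theorem for the distance to [w]. *)
Lemma path_meets_circle (gamma : R -> plane R) (a b : R) w (s : R) :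
  a <= b -> {within `[a, b], continuous gamma} ->
  enorm (gamma a - w) <= s -> s <= enorm (gamma b - w) ->
  exists2 c, c \in `[a, b] & enorm (gamma c - w) = s.
Proof.
move=> ab cg sa sb.
apply: (@IVT _ (fun t => enorm (gamma t - w)) a b s ab).
  move=> t.
  have := @continuous_comp (subspace `[a, b]) _ _ gamma
    (fun x => enorm (x - w)) t.
  apply; first exact: cg.
  apply: (@continuous_comp _ _ _ (fun x => x - w) (@enorm R)).
    by apply: cvgB; [exact: cvg_id|exact: cvg_cst].
  exact: enorm_continuous.
by rewrite ge_min le_max sa sb orbT.
Qed.

End EuclideanNorm.

(** * Clean points on paths that avoid the bad event *)

Section BadEvents.
Variable R : realType.
Implicit Types (S : config R) (w x y : plane R) (r s D : R).

(** Boxes are used instead of disks because their area is a product of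
    lengths; the loss is absorbed by the second term of [net_constant]. *)
Definition box w r : set (plane R) :=
  `[w.1 - r, w.1 + r]%classic `*` `[w.2 - r, w.2 + r]%classic.

Definition fast_marks w r v : set (mark R) :=
  box w r `*` [set h | v < speed_plus h].

Definition fast_atom_in w r v : set (config R) :=
  [set S | exists2 p, atoms S p & fast_marks w r v p].

(** Only pairs taken from two different circles are listed: the corresponding
    regions of the previous scale are disjoint. *)
Definition net_pairs (N1 N2 N3 : {fset plane R}) : seq (plane R * plane R) :=
  [seq (a, b) | a <- N1, b <- N2] ++ [seq (a, b) | a <- N1, b <- N3] ++
  [seq (a, b) | a <- N2, b <- N3].

Definition rad r0 (m : nat) : R := r0 * rho R ^+ m.

Lemma rad_gt0 r0 m : 0 < r0 -> 0 < rad r0 m.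
Proof. by move=> r0_gt0; rewrite mulr_gt0 // exprn_gt0 // ltr0n. Qed.

Lemma radS r0 m : rad r0 m.+1 = 100 * rad r0 m.
Proof. by rewrite /rad exprSr mulrA mulrC. Qed.

(** The factor 62 comes from the geometry: the points of interest at scale
    [m'.+1] lie within 61 inner radii of [w], and a disk of radius at most one
    inner radius that reaches them is centred within 62.  No disk is relevant at
    scale 0, where the event is empty. *)
Fixpoint bad (N : seq (plane R * plane R)) r0 (m : nat) w : set (config R) :=
  if m is m'.+1 then
    fast_atom_in w (62 * rad r0 m'.+1) (rad r0 m') `|`
    \bigcup_(u in [set` N])
      (bad N r0 m' (w + rad r0 m'.+1 *: u.1) `&`
       bad N r0 m' (w + rad r0 m'.+1 *: u.2))
  else set0.

(** The cut-off [r] on the radii of the disks makes the notion local: at scale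
    [m] it is used with [r] the inner radius. *)
Definition clean_point (V0 : R) S r x : Prop := forall p, atoms S p ->
  V0 <= speed p.2 -> speed_plus p.2 <= r -> ~ disk p.1 (speed_plus p.2) x.

Definition spread D (W : {fset plane R}) : Prop :=
  forall x y, x \in W -> y \in W -> x <> y -> D <= enorm (x - y).

Lemma spread_cup D W W' : spread D W -> spread D W' ->
  (forall x y, x \in W -> y \in W' -> D <= enorm (x - y)) ->
  spread D (W `|` W')%fset.
Proof.
move=> sW sW' sWW' x y /fsetUP[xW|xW] /fsetUP[yW|yW] xy.
- exact: sW.
- exact: sWW'.
- by rewrite enorm_distC sWW'.
- exact: sW'.
Qed.

Section CleanPoints.
Variables (V0 r0 : R) (N1 N2 N3 : {fset plane R}) (S : config R).
Hypothesis N1_net : circle_net 1 N1.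
Hypothesis N2_net : circle_net 2 N2.
Hypothesis N3_net : circle_net 3 N3.
Hypothesis r0_gt0 : 0 < r0.
Hypothesis V0_gt0 : 0 < V0.
Hypothesis r0_lt_V0 : r0 < V0 + 1.
Hypothesis V0_width : 6 * (V0 + 1) < r0 * (rho R - 1).

Let D := 3 * (V0 + 1).
Let N := net_pairs N1 N2 N3.

Definition good_points m w (gamma : R -> plane R) (a b : R)
    (W : {fset plane R}) :=
  [/\ (2 ^ m <= #|` W|)%N, spread D W &
     forall x, x \in W ->
       [/\ (gamma @` `[a, b]) x, clean_point V0 S (rad r0 m) x &
           rad r0 m + D <= enorm (x - w) <= rad r0 m.+1 - D]].

(** With [rad r0 m.+1 = 100 * rad r0 m] the inner radius of scale [m.+1], the
    points are those found near the circle of radius [20 * i] inner radii. *)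
Definition ring_points m (i : nat) w (gamma : R -> plane R) (a b : R)
    (W : {fset plane R}) :=
  [/\ (2 ^ m <= #|` W|)%N, spread D W &
     forall x, x \in W ->
       [/\ (gamma @` `[a, b]) x, clean_point V0 S (rad r0 m) x,
           2000 * i%:R * rad r0 m - 100 * rad r0 m <= enorm (x - w) &
           enorm (x - w) <= 2000 * i%:R * rad r0 m + 100 * rad r0 m]].

(** The path starts inside and ends outside, but may leave the annulus in
    between: this is all that is known of a piece of path around another
    centre. *)
Definition clean_crossing m := forall w (gamma : R -> plane R) (a b : R),
  a <= b -> {within `[a, b], continuous gamma} -> ~ bad N r0 m w S ->
  enorm (gamma a - w) <= rad r0 m -> rad r0 m.+1 <= enorm (gamma b - w) ->
  exists W, good_points m w gamma a b W.

Let width m : 2 * D < 99 * rad r0 m.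
Proof.
have : r0 <= rad r0 m.
  by rewrite /rad ler_peMr ?(ltW r0_gt0) // exprn_ege1 // ler1n.
move: V0_width; rewrite /rho /D; lra.
Qed.

Let D_gt0 : 0 < D.
Proof. by rewrite /D; move: V0_gt0; lra. Qed.

(** Polluting disks have radius at least [V0 + 1 > r0], hence none is counted
    at scale 0, and the point at mid-width of the annulus qualifies. *)
Lemma clean_crossing0 : clean_crossing 0.
Proof.
move=> w gamma a b ab cg _ ga gb.
set s := (rad r0 0 + rad r0 1) / 2.
have := width 0; have r_gt0 := rad_gt0 0 r0_gt0; have rS := radS r0 0.
move=> wd.
have [||c cab cs] := path_meets_circle (w := w) (s := s) ab cg.
- by apply: le_trans ga _; rewrite /s; lra.
- by apply: le_trans gb; rewrite /s; lra.
exists [fset gamma c]%fset; split.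
- by rewrite cardfs1.
- by move=> x y /fset1P -> /fset1P ->.
- move=> x /fset1P ->; split.
  + by exists c.
  + move=> p _ V0p; rewrite /rad expr0 mulr1 /speed_plus.
    by move: r0_lt_V0; lra.
  + by rewrite cs /s; apply/andP; split; lra.
Qed.

(** Where the path meets the circle of radius [20 * i] inner radii, rescaling
    gives a net point [u] whose disk of radius [rad r0 m] contains the
    meeting point; the end of the path is at least [rad r0 m.+1] away from the
    centre, so the path crosses the annulus of scale [m] around it. *)
Lemma sub_crossing m (i : nat) (Ni : {fset plane R}) w
    (gamma : R -> plane R) (a b : R) :
  circle_net i Ni -> (0 < i <= 3)%N -> clean_crossing m ->
  a <= b -> {within `[a, b], continuous gamma} ->
  enorm (gamma a - w) <= rad r0 m.+1 -> rad r0 m.+2 <= enorm (gamma b - w) ->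
  exists2 u, u \in Ni & ~ bad N r0 m (w + rad r0 m.+1 *: u) S ->
    exists W, ring_points m i w gamma a b W.
Proof.
move=> [Ni_circ Ni_cov] /andP[i_gt0 i_le3] IH ab cg ga gb.
have s_gt0 := rad_gt0 m r0_gt0.
move: ga gb; rewrite !radS; move: s_gt0.
set s := rad r0 m => s_gt0 ga gb.
have i_ge1 : 1 <= i%:R :> R by rewrite ler1n.
have i_le : i%:R <= 3 :> R by rewrite ler_nat.
have is_ge : s <= i%:R * s by nra.
have is_le : i%:R * s <= 3 * s by nra.
have [||c cab cs] := path_meets_circle (w := w) (s := 2000 * (i%:R * s)) ab cg.
- by apply: le_trans ga _; nra.
- by apply: le_trans gb; nra.
have s100 : 100 * s != 0 by rewrite gt_eqF //; nra.
pose v := (100 * s)^-1 *: (gamma c - w).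
have vE : (100 * s) *: v = gamma c - w by rewrite scalerA divff // scale1r.
have v_circle : circle 0 (20 * i%:R) v.
  rewrite /circle /= subr0 enorm_scale ?invr_ge0 ?cs; last by nra.
  by field; rewrite gt_eqF.
have [u uN vu] := Ni_cov _ v_circle.
have u_norm : enorm u = 20 * i%:R.
  by have := Ni_circ _ uN; rewrite /circle /= subr0.
exists u => // nb.
move: cab; rewrite in_itv /= => /andP[ac cb].
have cgc : {within `[c, b], continuous gamma}.
  apply: continuous_subspaceW cg => t /=; rewrite !in_itv /= => /andP[ct ->].
  by rewrite (le_trans ac ct).
have su_norm : enorm ((100 * s) *: u) = 2000 * (i%:R * s).
  by rewrite enorm_scale ?u_norm; nra.
have [||W [W_card W_spread W_pts]] :=
  IH (w + (100 * s) *: u) gamma c b cb cgc nb.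
- rewrite opprD addrA -vE -scalerBr -/s enorm_scale; last by nra.
  move: vu; rewrite /disk /= /rho => vu.
  have : 100 * enorm (v - u) <= 1 by lra.
  move: s_gt0; nra.
- have := ler_enormD (gamma b - (w + (100 * s) *: u)) ((100 * s) *: u).
  rewrite opprD addrA subrK su_norm radS -/s; nra.
exists W; split=> // x xW; have [[t tcb xE] cl /andP[_ xw]] := W_pts _ xW.
have xw' : enorm (x - (w + (100 * s) *: u)) <= 100 * s.
  by move: xw D_gt0; rewrite radS -/s; lra.
have xwE : x - w = (x - (w + (100 * s) *: u)) + (100 * s) *: u.
  by rewrite opprD addrA subrK.
split=> //; rewrite -/s.
- exists t => //; move: tcb; rewrite /= !in_itv /= => /andP[ct ->].
  by rewrite (le_trans ac ct).
- have := ler_enormD (x - w) (- (x - (w + (100 * s) *: u))).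
  by rewrite enormN {1}xwE addrAC subrr add0r su_norm -mulrA; lra.
- by have := ler_enormD (x - (w + (100 * s) *: u)) ((100 * s) *: u);
    rewrite -xwE su_norm -mulrA; lra.
Qed.

(** Among the three net points, at most one is bad, since two bad ones would
    make the larger scale bad.  Points found around the two others lie in
    distinct rings, well apart, and their number adds up to [2 ^ m.+1].  A disk
    counted at scale [m.+1] but not at scale [m] cannot cover one of them: its
    centre would be the atom that makes the larger scale bad. *)
Lemma clean_crossingS m : clean_crossing m -> clean_crossing m.+1.
Proof.
move=> IH w gamma a b ab cg nbad ga gb.
have s_gt0 := rad_gt0 m r0_gt0; have D_lt := width m.
have merge i j Wi Wj : (0 < i)%N -> (i < j <= 3)%N ->
    ring_points m i w gamma a b Wi -> ring_points m j w gamma a b Wj ->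
    exists W, good_points m.+1 w gamma a b W.
  move=> i_gt0 /andP[ij j_le3] [ci si pi] [cj sj pj].
  have iR : 1 <= i%:R :> R by rewrite ler1n.
  have ijR : i%:R + 1 <= j%:R :> R by rewrite natr1 ler_nat.
  have jR : j%:R <= 3 :> R by rewrite ler_nat.
  have far x y : x \in Wi -> y \in Wj -> D <= enorm (x - y).
    move=> /pi[_ _ _ xw] /pj[_ _ yw _].
    have := ler_enorm_dist y x w; rewrite (enorm_distC y x); nra.
  exists (Wi `|` Wj)%fset; split.
  - suff /eqP dij : (Wi `&` Wj)%fset == fset0.
      have := cardfsUI Wi Wj; rewrite dij cardfs0 addn0 => ->.
      by rewrite expnS mulSn mul1n leq_add.
    apply/eqP/fsetP => x; rewrite in_fset0; apply/negP => /fsetIP[xi xj].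
    by have := far _ _ xi xj; rewrite subrr enorm0 leNgt D_gt0.
  - exact: spread_cup.
  - move=> x xW.
    have [gx clx x_ge x_le] : [/\ (gamma @` `[a, b]) x,
        clean_point V0 S (rad r0 m) x, 1900 * rad r0 m <= enorm (x - w) &
        enorm (x - w) <= 6100 * rad r0 m].
      by case/fsetUP: xW => [/pi|/pj] [? ? ? ?]; split => //; nra.
    split=> //; last by rewrite !radS; apply/andP; split; lra.
    move=> p Sp V0p p_le px.
    have [p_slow|p_fast] := leP (speed_plus p.2) (rad r0 m).
      exact: clx p_slow px.
    apply: nbad; left; exists p => //; split => //.
    have pw : enorm (p.1 - w) <= 62 * rad r0 m.+1.
      have := ler_enorm_dist p.1 x w.
      move: px; rewrite /disk /= (enorm_distC x p.1).
      by move: p_le; rewrite !radS; lra.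
    have := norm_fst_le_enorm (p.1 - w); have := norm_snd_le_enorm (p.1 - w).
    rewrite !ler_norml /= => /andP[? ?] /andP[? ?].
    by split; rewrite /= in_itv /=; apply/andP; split; lra.
have [u1 u1N p1] := sub_crossing (i := 1) N1_net isT IH ab cg ga gb.
have [u2 u2N p2] := sub_crossing (i := 2) N2_net isT IH ab cg ga gb.
have [u3 u3N p3] := sub_crossing (i := 3) N3_net isT IH ab cg ga gb.
have not_both u v : (u, v) \in N -> bad N r0 m (w + rad r0 m.+1 *: u) S ->
    ~ bad N r0 m (w + rad r0 m.+1 *: v) S.
  by move=> uv bu bv; apply: nbad; right; exists (u, v).
have b12 := not_both u1 u2; have b13 := not_both u1 u3.
have b23 := not_both u2 u3.
have u12N : (u1, u2) \in N by rewrite !mem_cat allpairs_f.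
have u13N : (u1, u3) \in N by rewrite !mem_cat (allpairs_f pair u1N u3N) orbT.
have u23N : (u2, u3) \in N
  by rewrite !mem_cat (allpairs_f pair u2N u3N) !orbT.
have [bu1|/p1[W1 g1]] := pselect (bad N r0 m (w + rad r0 m.+1 *: u1) S).
  have [W2 g2] := p2 (b12 u12N bu1); have [W3 g3] := p3 (b13 u13N bu1).
  exact: (merge 2 3) g2 g3.
have [bu2|/p2[W2 g2]] := pselect (bad N r0 m (w + rad r0 m.+1 *: u2) S).
  have [W3 g3] := p3 (b23 u23N bu2).
  exact: (merge 1 3) g1 g3.
exact: (merge 1 2) g1 g2.
Qed.

Lemma clean_crossing_all m : clean_crossing m.
Proof.
by elim: m => [|m]; [exact: clean_crossing0|exact: clean_crossingS].
Qed.

End CleanPoints.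
End BadEvents.

(** * Measurability of the speed *)

Section SpeedMeasurable.
Variable R : realType.

Lemma measurable_enorm : measurable_fun [set: plane R] (@enorm R).
Proof.
apply: (@measurableT_comp _ _ _ _ _ _ (@Num.sqrt R)).
  by apply: continuous_measurable_fun; exact: sqrt_continuous.
by apply: measurable_funD; apply: measurable_funX.
Qed.

(** Composing with [clamp] replaces the interval of times by the whole line, in
    which the rationals are dense. *)
Definition clamp (t : R) : R := Num.max 0 (Num.min 1 t).

Lemma clamp_itv t : clamp t \in `[0, 1].
Proof. by rewrite in_itv /= le_max lexx /= ge_max ler01 ge_min lexx. Qed.

Lemma clampK t : t \in `[0, 1] -> clamp t = t.
Proof.
by rewrite in_itv /= => /andP[t0 t1]; rewrite /clamp min_r // max_r.
Qed.

Lemma clamp_continuous : continuous clamp.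
Proof.
move=> t; apply: continuous_max; first exact: cvg_cst.
by apply: continuous_min; [exact: cvg_cst|exact: cvg_id].
Qed.

(** By continuity the supremum may be taken over rational times, which turns
    the event that the speed is large into a countable union of cylinders. *)
Lemma speed_gtP (h : trajectory R) (v : R) :
  v < speed h <-> exists q : rat, v < enorm (h (clamp (ratr q))).
Proof.
have cont : continuous (fun t => enorm (h (clamp t))).
  move=> t; apply: (@continuous_comp _ _ _ clamp (fun t => enorm (h t))).
    exact: clamp_continuous.
  apply: (@continuous_comp _ _ _ h (@enorm R)).
    exact: trajectory_continuous.
  exact: enorm_continuous.
have has : has_sup [set enorm (h s) | s in `[0, 1]].
  split; first by exists (enorm (h 0)), 0 => //=; rewrite in_itv /= lexx ler01.
  have [|c c01 cmax] := @EVT_max R (fun t => enorm (h t)) 0 1 ler01.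
    apply: continuous_subspaceT => t.
    apply: (@continuous_comp _ _ _ h (@enorm R)).
      exact: trajectory_continuous.
    exact: enorm_continuous.
  by exists (enorm (h c)) => _ [t t01 <-]; exact: cmax.
split=> [vs|[q vq]]; last first.
  apply: (lt_le_trans vq); apply: sup_upper_bound => //.
  by exists (clamp (ratr q)) => //; exact: clamp_itv.
have [_ [t t01 <-] vt] := sup_gt has.1 vs.
have op : open [set s | v < enorm (h (clamp s))].
  exact: (open_comp (fun s _ => cont s) (@open_gt _ v)).
have ne : [set s | v < enorm (h (clamp s))] !=set0.
  by exists t; rewrite /= clampK.
by have [s [vs' [q _ qs]]] := dense_rat ne op; exists q; rewrite qs.
Qed.

Lemma measurable_speed : measurable_fun [set: trajectory R] (@speed R).
Proof.
move=> mT; apply: (measurability _ (RGenOInfty.measurableE R)) => //.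
move=> _ [_ [v ->] <-]; rewrite setTI.
rewrite (_ : _ @^-1` _ =
  \bigcup_(q : rat) [set h : trajectory R |
    [set x | v < enorm x] (h (clamp (ratr q)))]).
  apply: bigcupT_measurable_rat => q.
  apply: sub_sigma_algebra; exists (clamp (ratr q)) => //.
  exists [set x | v < enorm x] => //=.
  have /(_ measurableT `]v, +oo[%classic) := measurable_enorm.
  rewrite setTI => mm.
  rewrite (_ : [set x | _] = @enorm R @^-1` `]v, +oo[%classic).
    exact: mm.
  by apply/seteqP; split=> x /=; rewrite in_itv /= andbT.
apply/seteqP; split=> [h|h [q _]] /=; rewrite in_itv /= andbT.
  by move=> /speed_gtP[q vq]; exists q.
by move=> vq; apply/speed_gtP; exists q.
Qed.

Lemma measurable_speed_plus :
  measurable_fun [set: trajectory R] (@speed_plus R).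
Proof.
by apply: measurable_funD; [exact: measurable_speed|exact: measurable_cst].
Qed.

Lemma measurable_fast (v : R) :
  measurable [set h : trajectory R | v < speed_plus h].
Proof.
have := measurable_speed_plus measurableT (measurable_itv `]v, +oo[).
rewrite setTI; congr measurable.
by apply/seteqP; split=> h /=; rewrite in_itv /= andbT.
Qed.

Lemma measurable_box (w : plane R) (r : R) : measurable (box w r).
Proof. by apply: measurableX; exact: measurable_itv. Qed.

Lemma measurable_fast_marks (w : plane R) (r v : R) :
  measurable (fast_marks w r v).
Proof.
by apply: measurableX; [exact: measurable_box|exact: measurable_fast].
Qed.

End SpeedMeasurable.

(** * Independence of disjoint regions in a Poisson process *)

Section EmptyEvents.
Variables (R : realType) (d : measure_display) (Omega : measurableType d).
Variable P : probability Omega R.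
Local Open Scope ereal_scope.

(** The events independent of [B] form a Dynkin system. *)
Lemma indep_g_sigma_algebra (G : set (set Omega)) (B : set Omega) :
  setI_closed G -> G `<=` measurable -> measurable B ->
  (forall A, G A -> P (A `&` B) = P A * P B) ->
  forall A, <<s G >> A -> P (A `&` B) = P A * P B.
Proof.
move=> GI Gm mB GB.
suff : <<s G >> `<=` [set A | measurable A /\ P (A `&` B) = P A * P B].
  by move=> sub A /sub[].
rewrite -setI_closed_g_dynkin_g_sigma_algebra //.
apply: smallest_sub; last by move=> A GA; split; [exact: Gm|exact: GB].
split.
- by split => //; rewrite setTI probability_setT mul1e.
- move=> A [mA PA]; split; first exact: measurableC.
  rewrite setIC -setDE measureD //;
    last by rewrite (le_lt_trans (probability_le1 _ _)) ?ltry.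
  rewrite (_ : _ - _ = P B - P A * P B);
    last by congr (_ - _); rewrite setIC; exact: PA.
  by rewrite probability_setC // muleBl ?mul1e // ?fin_num_measure //
    fin_num_adde_defr.
- move=> F tF mF; split.
    by apply: bigcupT_measurable => k; case: (mF k).
  rewrite setI_bigcupl !measure_bigcup //.
  + rewrite (eq_eseriesr (g := fun k => (fine (P B))%:E * P (F k))).
      by rewrite nneseriesZl // fineK ?fin_num_measure // muleC.
    move=> k _; rewrite fineK ?fin_num_measure // muleC.
    by case: (mF k).
  + by move=> k _; case: (mF k).
  + by move=> k _; apply: measurableI => //; case: (mF k).
  + exact: trivIset_setIr.
Qed.

Lemma indep_g_sigma_algebra2 (G1 G2 : set (set Omega)) :
  setI_closed G1 -> setI_closed G2 ->
  G1 `<=` measurable -> G2 `<=` measurable ->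
  (forall A B, G1 A -> G2 B -> P (A `&` B) = P A * P B) ->
  forall A B, <<s G1 >> A -> <<s G2 >> B -> P (A `&` B) = P A * P B.
Proof.
move=> G1I G2I G1m G2m G12 A B sA sB.
have mB : measurable B.
  apply: smallest_sub sB => //; exact: sigma_algebra_measurable.
apply: (indep_g_sigma_algebra G1I G1m mB) sA => A' GA'.
rewrite setIC muleC; apply: (indep_g_sigma_algebra G2I G2m (G1m _ GA')) sB.
by move=> B' GB'; rewrite setIC muleC; exact: G12.
Qed.

Variable xi : {RV P >-> config R}.

Definition empty_on (A : set (mark R)) : set Omega :=
  [set w | atom_count A (xi w) = 0].

Lemma atom_count0 (A : set (mark R)) (S : config R) :
  atom_count A S = 0 <-> atoms S `&` A = set0.
Proof.
rewrite /atom_count /counting; case: asboolP => [fin|inf]; split => //.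
- move=> [] /eqP; rewrite pnatr_eq0 cardfs_eq0 => /eqP A0.
  by rewrite -(fset_setK fin) A0; apply/seteqP; split => x.
- by move=> ->; rewrite fset_set0 cardfs0.
- by move=> A0; exfalso; apply: inf; rewrite A0.
Qed.

Lemma empty_onU A B : empty_on (A `|` B) = empty_on A `&` empty_on B.
Proof.
apply/seteqP; split=> w /=.
  by move=> /atom_count0; rewrite setIUr setU_eq0 => -[? ?]; split;
    apply/atom_count0.
by move=> [/atom_count0 wA /atom_count0 wB]; apply/atom_count0;
  rewrite setIUr wA wB setU0.
Qed.

Lemma measurable_empty_on A : measurable A -> measurable (empty_on A).
Proof.
move=> mA; rewrite -[empty_on A]setTI.
have -> : empty_on A = xi @^-1` (atom_count A @^-1` [set 0]) by [].
apply: (measurable_funP xi); first exact: measurableT.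
apply: sub_sigma_algebra; exists A => //; exists [set 0] => //.
  exact: emeasurable_set1.
Qed.

(** Emptiness events are enough to describe [bad], and unlike general counting
    events they are stable under intersection, because two regions are both
    empty iff their union is. *)
Definition empty_events (D : set (mark R)) : set (set Omega) :=
  [set empty_on A | A in [set A | measurable A /\ A `<=` D]].

Lemma empty_events_setI_closed D : setI_closed (empty_events D).
Proof.
move=> _ _ [A [mA AD] <-] [B [mB BD] <-]; exists (A `|` B).
  by split; [exact: measurableU|rewrite subUset].
exact: empty_onU.
Qed.

Lemma empty_events_measurable D : empty_events D `<=` measurable.
Proof. by move=> _ [A [mA _] <-]; exact: measurable_empty_on. Qed.

Lemma empty_sigma_measurable D E : <<s empty_events D >> E -> measurable E.
Proof.
apply: smallest_sub;
  [exact: sigma_algebra_measurable|exact: empty_events_measurable].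
Qed.

Lemma empty_sigmaS D D' : D `<=` D' ->
  <<s empty_events D >> `<=` <<s empty_events D' >>.
Proof.
move=> DD'; apply: sub_sigma_algebra2 => _ [A [mA AD] <-]; exists A => //.
by split => //; exact: subset_trans DD'.
Qed.

Variable Lambda : set (mark R) -> \bar R.
Hypothesis Lambda_ge0 : forall A, 0 <= Lambda A.
Hypothesis xi_poisson : poisson_process Lambda xi.

(** On generators this is the product rule of the Poisson process for two
    disjoint regions and zero counts. *)
Lemma empty_sigma_indep D1 D2 E1 E2 : D1 `&` D2 = set0 ->
  <<s empty_events D1 >> E1 -> <<s empty_events D2 >> E2 ->
  P (E1 `&` E2) = P E1 * P E2.
Proof.
move=> D12; apply: indep_g_sigma_algebra2; try exact: empty_events_setI_closed;
  try exact: empty_events_measurable.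
move=> _ _ [A [mA AD] <-] [B [mB BD] <-].
have [_ _ indep] := xi_poisson.
have := indep 2%N (fun i => if i == ord0 then A else B) (fun=> 0).
rewrite !big_ord_recl big_ord0 mule1 /= => <-.
- congr (P _); apply/seteqP; split=> w /=.
    by move=> [wA wB] i _; case: ifP.
  by move=> wAB; split; [exact: (wAB ord0)|exact: (wAB (lift ord0 ord0))].
- by move=> i; case: ifP.
- apply/trivIsetP => i j _ _.
  have AB : A `&` B = set0.
    by rewrite -subset0 -D12; exact: setISS.
  move=> ij; case: ifPn => i0; case: ifPn => j0 //.
  + by move: ij; rewrite (eqP i0) (eqP j0) eqxx.
  + by rewrite setIC.
  + by move: i j i0 j0 ij => [[|[|//]] ?] [[|[|//]] ?].
Qed.

(** [1 - exp (- x) <= x], with [x] the intensity of the region. *)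
Lemma prob_nonempty_le A : measurable A -> P (~` empty_on A) <= Lambda A.
Proof.
move=> mA; have mV := measurable_empty_on mA.
have [fin|] := ltP (Lambda A) +oo; last first.
  by rewrite leye_eq => /eqP ->; exact: leey.
have LE : Lambda A = (fine (Lambda A))%:E by rewrite fineK // ge0_fin_numE.
have [pois _ _] := xi_poisson.
rewrite probability_setC //.
rewrite (_ : P (empty_on A) = poisson_prob (fine (Lambda A)) 0%N [set 0%N]);
  last exact: (pois A 0%N mA fin).
rewrite {2}LE /poisson_prob; case: ifPn => [l0|l0].
  rewrite esum_set1 ?lee_fin /poisson_pmf l0 /=; last first.
    by rewrite !mulr_ge0 ?expR_ge0.
  rewrite expr0 fact0 invr1 !mul1r.
  by have := expR_ge1Dx (- fine (Lambda A)); lra.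
rewrite diracE mem_set // subee // -LE; exact: Lambda_ge0.
Qed.

End EmptyEvents.

(** * Consequences of the second moment *)

Section SecondMoment.
Variables (R : realType) (mu : probability (trajectory R) R) (r0 : R).
Hypothesis r0_gt0 : 0 < r0.
Hypothesis mu_moment2 : (\int[mu]_h ((speed h) ^+ 2)%:E < +oo)%E.

Local Notation fast v := [set h : trajectory R | v < speed_plus h].
Let r := rad r0.

(** Up to a constant, the expected number of atoms in a box of size [rad r0 m]
    whose disk has a radius above [rad r0 m]. *)
Definition tail_moment (m : nat) : R := r m ^+ 2 * fine (mu (fast (r m))).

Lemma tail_moment_ge0 m : 0 <= tail_moment m.
Proof. by rewrite mulr_ge0 ?sqr_ge0 // fine_ge0. Qed.

Lemma tail_momentE m :
  (tail_moment m)%:E = ((r m ^+ 2)%:E * mu (fast (r m)))%E.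
Proof.
by rewrite EFinM fineK // fin_num_measure //; exact: measurable_fast.
Qed.

Lemma radius_sqr_sum (K : nat) : \sum_(m < K.+1) r m ^+ 2 <= 2 * r K ^+ 2.
Proof.
elim: K => [|K IH].
  by rewrite big_ord_recl big_ord0; have := sqr_ge0 (r 0); lra.
rewrite big_ord_recr /=; apply: le_trans (lerD IH (lexx _)) _.
by rewrite /r radS; have := sqr_ge0 (rad r0 K); nra.
Qed.

(** The squares of the radii below [v] are dominated by the last one, since
    they grow geometrically. *)
Lemma radius_sqr_sum_fast (v : R) (K : nat) :
  \sum_(m < K) r m ^+ 2 * (r m < v)%R%:R <= 2 * v ^+ 2.
Proof.
elim: K => [|K IH]; first by rewrite big_ord0 mulr_ge0 // sqr_ge0.
have [rv|rv] := ltP (r K) v; last first.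
  by rewrite big_ord_recr /= ltNge rv mulr0 addr0.
apply: (@le_trans _ _ (2 * r K ^+ 2)).
  apply: le_trans (radius_sqr_sum K); apply: ler_sum => m _.
  by rewrite ler_piMr ?sqr_ge0 // -[leRHS]/(1%:R) ler_nat leq_b1.
have r_gt0 : 0 < r K by exact: rad_gt0.
by nra.
Qed.

Let speed_plus_sqr_measurable (D : set (trajectory R)) :
  measurable_fun D (fun h => (speed_plus h ^+ 2)%:E).
Proof.
apply/measurable_EFinP; apply: measurable_funX; apply: measurable_funTS.
exact: measurable_speed_plus.
Qed.

Lemma speed_plus_moment2 : (\int[mu]_h (speed_plus h ^+ 2)%:E < +oo)%E.
Proof.
have mV2 : measurable_fun setT (fun h : trajectory R => (speed h ^+ 2)%:E).
  by apply/measurable_EFinP; apply: measurable_funX; exact: measurable_speed.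
apply: (@le_lt_trans _ _ (\int[mu]_h (2%:E * (speed h ^+ 2)%:E + 2%:E))%E).
  apply: ge0_le_integral => //.
  - by move=> h _; rewrite lee_fin sqr_ge0.
  - by apply: emeasurable_funD => //; exact: measurable_funeM.
  - move=> h _; rewrite -EFinM -EFinD lee_fin /speed_plus.
    by have := sqr_ge0 (speed h - 1); nra.
rewrite ge0_integralD //=.
- rewrite ge0_integralZl_EFin //.
  + rewrite integral_cst // lte_add_pinfty //; apply: lte_mul_pinfty => //.
    by apply: (le_lt_trans (probability_le1 mu measurableT)); rewrite ltry.
  + by move=> h _; rewrite lee_fin sqr_ge0.
- by move=> h _; rewrite -EFinM lee_fin mulr_ge0 // sqr_ge0.
- exact: measurable_funeM.
Qed.

(** Integrate [radius_sqr_sum_fast]. *)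
Lemma tail_moment_summable :
  exists B : R, forall K, \sum_(m < K) tail_moment m <= B.
Proof.
pose I := (\int[mu]_h (speed_plus h ^+ 2)%:E)%E.
have I_fin : I \is a fin_num.
  rewrite ge0_fin_numE; first exact: speed_plus_moment2.
  by apply: integral_ge0 => h _; rewrite lee_fin sqr_ge0.
exists (2 * fine I) => K; rewrite -lee_fin EFinM fineK // -sumEFin.
have fastE m : (tail_moment m)%:E =
    (\int[mu]_h ((r m ^+ 2)%:E * (\1_(fast (r m)) h)%:E))%E.
  rewrite ge0_integralZl_EFin ?sqr_ge0 //.
  - by rewrite integral_indic ?setIT ?tail_momentE //; exact: measurable_fast.
  - by apply/measurable_EFinP; apply: measurable_indic; exact: measurable_fast.
rewrite (eq_bigr (fun m : 'I_K => \int[mu]_h ((r m ^+ 2)%:E *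
  (\1_(fast (r m)) h)%:E))%E); last by move=> m _; exact: fastE.
rewrite -ge0_integral_sum //; last 2 first.
- move=> m; apply: measurable_funeM; apply/measurable_EFinP.
  by apply: measurable_indic; exact: measurable_fast.
- by move=> m h _; rewrite -EFinM lee_fin mulr_ge0 // sqr_ge0.
rewrite -ge0_integralZl_EFin //; last by move=> h _; rewrite lee_fin sqr_ge0.
apply: ge0_le_integral => //.
- move=> h _; apply: sume_ge0 => m _.
  by rewrite -EFinM lee_fin mulr_ge0 // sqr_ge0.
- apply: emeasurable_sum => m; apply: measurable_funeM; apply/measurable_EFinP.
  by apply: measurable_indic; exact: measurable_fast.
- exact: measurable_funeM.
- move=> h _; rewrite -EFinM.
  rewrite (eq_bigr (fun m : 'I_K => (r m ^+ 2 * (r m < speed_plus h)%R%:R)%:E)).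
    by rewrite sumEFin lee_fin radius_sqr_sum_fast.
  by move=> m _; rewrite -EFinM indicE mem_setE.
Qed.

(** Chebyshev's inequality. *)
Lemma tail_moment_le_integral m (c : R) : c <= r m ->
  ((tail_moment m)%:E <=
    \int[pushforward mu (@speed_plus R)]_(v in `]c, +oo[) (v ^+ 2)%:E)%E.
Proof.
move=> cr; have r_gt0 : 0 < r m by exact: rad_gt0.
have sq_ge0 v : (0 <= (v ^+ 2)%:E :> \bar R)%E by rewrite lee_fin sqr_ge0.
rewrite ge0_integral_pushforward //; last first.
- by apply/measurable_EFinP; apply: measurable_funX.
- exact: measurable_speed_plus.
have mfast v : measurable (@speed_plus R @^-1` `]v, +oo[%classic).
  rewrite -[_ @^-1` _]setTI.
  by apply: measurable_speed_plus => //; exact: measurable_itv.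
have fastE v : @speed_plus R @^-1` `]v, +oo[%classic = fast v.
  by apply/seteqP; split=> h /=; rewrite in_itv /= andbT.
apply: (@le_trans _ _ (\int[mu]_(h in fast (r m)) (speed_plus h ^+ 2)%:E)%E).
  rewrite tail_momentE -integral_cst; last exact: measurable_fast.
  apply: ge0_le_integral => //.
  - exact: measurable_fast.
  - by move=> h _; exact: sq_ge0.
  - move=> h /= rh; rewrite /= lee_fin ler_pXn2r ?nnegrE //; first exact: ltW.
      exact: ltW.
    by rewrite ltW // (lt_trans r_gt0).
apply: ge0_subset_integral => //; first exact: measurable_fast.
rewrite fastE => h /=; exact: le_lt_trans.
Qed.

End SecondMoment.

(** * Probability of the bad event *)

Section BadProbability.
Variables (R : realType) (mu : probability (trajectory R) R).
Variables (d : measure_display) (Omega : measurableType d).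
Variables (P : probability Omega R) (xi : {RV P >-> config R}).
Let Lambda := ((lebesgue_measure \x lebesgue_measure) \x mu)%E.
Hypothesis xi_poisson : poisson_process Lambda xi.

Lemma fast_atom_nonempty w r v :
  xi @^-1` (fast_atom_in w r v) = ~` empty_on xi (fast_marks w r v).
Proof.
apply/seteqP; split=> om /=.
  move=> [p Sp fp] /atom_count0 S0.
  by have : (atoms (xi om) `&` fast_marks w r v) p by []; rewrite S0.
move=> nv; apply: contrapT => nf; apply: nv; apply/atom_count0.
by apply/seteqP; split => // p [Sp fp]; apply: nf; exists p.
Qed.

Lemma Lambda_fast_marks w r v : 0 < r ->
  Lambda (fast_marks w r v) =
    ((4 * r ^+ 2)%:E * mu [set h | (v < speed_plus h)%R])%E.
Proof.
move=> r_gt0; rewrite /Lambda /fast_marks /box.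
have len (a : R) : lebesgue_measure `[a - r, a + r]%classic = (2 * r)%:E.
  rewrite lebesgue_measure_itv /= lte_fin ifT; last by lra.
  by rewrite -EFinB; congr (_%:E); ring.
rewrite product_measure1E; last 2 first.
- exact: measurable_box.
- exact: measurable_fast.
congr (_ * _)%E.
apply: eq_trans; first by apply: product_measure1E; exact: measurable_itv.
apply: eq_trans (congr2 mule (len w.1) (len w.2)) _.
by rewrite -EFinM; congr (_%:E); ring.
Qed.

Lemma prob_fast_atom_le w r v : 0 < r ->
  (P (xi @^-1` (fast_atom_in w r v)) <=
    (4 * r ^+ 2 * fine (mu [set h | (v < speed_plus h)%R]))%:E)%E.
Proof.
move=> r_gt0; rewrite fast_atom_nonempty.
apply: le_trans (prob_nonempty_le _ xi_poisson (measurable_fast_marks _ _ _)) _.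
  by move=> A; exact: measure_ge0.
rewrite Lambda_fast_marks // [X in (_ <= X)%E]EFinM fineK // fin_num_measure //.
exact: measurable_fast.
Qed.

Section Recursion.
Variables (N : seq (plane R * plane R)) (r0 : R).
Hypothesis r0_gt0 : 0 < r0.
Hypothesis N_apart : forall u, u \in N ->
  [/\ enorm u.1 <= 60, enorm u.2 <= 60 & 20 <= enorm u.2 - enorm u.1].
Local Notation r := (rad r0).
Local Notation bad := (bad N r0).

Definition marks_over (B : set (plane R)) : set (mark R) := B `*` setT.

Lemma in_box_shift (w u x : plane R) (c s : R) : box (w + c *: u) s x <->
  (w.1 + c * u.1 - s <= x.1 <= w.1 + c * u.1 + s) /\
  (w.2 + c * u.2 - s <= x.2 <= w.2 + c * u.2 + s).
Proof. by rewrite /box; split=> -[]; rewrite /= !in_itv. Qed.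

Lemma box_sub (w u : plane R) m : enorm u <= 60 ->
  box (w + r m.+1 *: u) (62 * r m) `<=` box w (62 * r m.+1).
Proof.
move=> u60; have r_gt0 := rad_gt0 m r0_gt0.
have := le_trans (norm_fst_le_enorm u) u60.
have := le_trans (norm_snd_le_enorm u) u60.
rewrite radS !ler_norml => /andP[? ?] /andP[? ?] x.
move=> /in_box_shift[/andP[? ?] /andP[? ?]].
by split; rewrite /= in_itv /=; apply/andP; split; nra.
Qed.

(** The half-width of the boxes is less than one inner radius, whereas their
    centres lie on circles whose radii differ by at least 20 inner radii. *)
Lemma box_disjoint (w : plane R) u m : u \in N ->
  box (w + r m.+1 *: u.1) (62 * r m) `&` box (w + r m.+1 *: u.2) (62 * r m) =
    set0.
Proof.
move=> /N_apart[_ _ u12]; have r_gt0 := rad_gt0 m r0_gt0.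
apply/seteqP; split => // x [/in_box_shift[a1 a2] /in_box_shift[b1 b2]].
have close (a b y z : R) :
    z + r m.+1 * a - 62 * r m <= y <= z + r m.+1 * a + 62 * r m ->
    z + r m.+1 * b - 62 * r m <= y <= z + r m.+1 * b + 62 * r m ->
    `|b - a| <= 2.
  by rewrite radS ler_norml => /andP[? ?] /andP[? ?];
    apply/andP; split; nra.
have := close _ _ _ _ a1 b1; have := close _ _ _ _ a2 b2.
rewrite !ler_norml => /andP[? ?] /andP[? ?].
have : enorm (u.2 - u.1) ^+ 2 < 20 ^+ 2 by rewrite sqr_enorm /=; nra.
rewrite ltr_pXn2r ?nnegrE ?enorm_ge0 //.
have := ler_enormD (u.2 - u.1) u.1; rewrite subrK; lra.
Qed.

(** The region on which [bad] depends grows by a bounded factor only: the boxes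
    of the previous scale fit into the box of the current one. *)
Lemma bad_local m w :
  <<s empty_events xi (marks_over (box w (62 * r m))) >> (xi @^-1` bad m w).
Proof.
elim: m w => [|m IH] w /=.
  rewrite preimage_set0.
  exact: (@measurable0 _ (g_sigma_algebraType (empty_events xi _))).
rewrite preimage_setU preimage_bigcup.
set G := empty_events xi _.
apply: (@measurableU _ (g_sigma_algebraType G)).
  rewrite fast_atom_nonempty.
  apply: (@measurableC _ (g_sigma_algebraType G)).
  apply: sub_sigma_algebra; exists (fast_marks w (62 * r m.+1) (r m)) => //.
  by split; [exact: measurable_fast_marks|move=> x [? _]; split].
apply: (@fin_bigcup_measurable _ (g_sigma_algebraType G)) => [|u uN].
  exact: finite_seq.
have [u1 u2 _] := N_apart uN.
rewrite preimage_setI.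
by apply: (@measurableI _ (g_sigma_algebraType G)); apply: empty_sigmaS (IH _);
  move=> x [xb _]; split => //; exact: box_sub xb.
Qed.

Lemma measurable_bad m w : measurable (xi @^-1` bad m w).
Proof. exact: empty_sigma_measurable (@bad_local m w). Qed.

Lemma prob_bigcup_seq_le (T : choiceType) (s : seq T) (F : T -> set Omega)
    (c : R) :
  (forall i, i \in s -> measurable (F i)) ->
  (forall i, i \in s -> P (F i) <= c%:E)%E ->
  (P (\bigcup_(i in [set` s]) F i) <= ((size s)%:R * c)%:E)%E.
Proof.
elim: s => [|i s IH] mF Fc.
  by rewrite set_nil bigcup_set0 measure0 mul0r.
have -> : [set` i :: s] = i |` [set` s].
  apply/seteqP; split=> j /=; rewrite in_cons.
    by move=> /orP[/eqP ->|js]; [left|right].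
  by move=> [->|->]; rewrite ?eqxx ?orbT.
rewrite bigcup_setU1 /= -natr1 mulrDl mul1r addrC EFinD.
have mF' j : j \in s -> measurable (F j).
  by move=> js; apply: mF; rewrite in_cons js orbT.
apply: le_trans (measureU2 _ _ _) _.
- by apply: mF; rewrite mem_head.
- by apply: fin_bigcup_measurable => //; exact: finite_seq.
apply: leeD; first by apply: Fc; rewrite mem_head.
by apply: IH => // j js; apply: Fc; rewrite in_cons js orbT.
Qed.

Definition fast_bound m : R :=
  4 * (62 * r m.+1) ^+ 2 * fine (mu [set h | r m < speed_plus h]).

Lemma fast_boundE m : fast_bound m = 4 * 6200 ^+ 2 * tail_moment mu r0 m.
Proof. by rewrite /fast_bound /tail_moment radS; ring. Qed.

Fixpoint bad_bound (C : R) m : R :=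
  if m is m'.+1 then C * bad_bound C m' ^+ 2 + fast_bound m' else 0.

(** Union bound over the pairs of net points, with independence for each pair.
    A bound uniform in the centre is what lets the induction go through. *)
Lemma prob_bad_le (C : R) m w : (size N)%:R <= C ->
  (P (xi @^-1` bad m w) <= (bad_bound C m)%:E)%E.
Proof.
move=> NC; elim: m w => [|m IH] w /=.
  by rewrite preimage_set0 measure0.
have r_gt0 := rad_gt0 m.+1 r0_gt0.
rewrite preimage_setU preimage_bigcup addrC EFinD.
have mBB u : measurable (xi @^-1` (bad m (w + r m.+1 *: u.1) `&`
    bad m (w + r m.+1 *: u.2))).
  by rewrite preimage_setI; apply: measurableI; exact: measurable_bad.
apply: le_trans (measureU2 _ _ _) _.
- rewrite fast_atom_nonempty; apply: measurableC; apply: measurable_empty_on.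
  exact: measurable_fast_marks.
- by apply: fin_bigcup_measurable => // ; exact: finite_seq.
apply: leeD; first by apply: prob_fast_atom_le; lra.
apply: (@le_trans _ _ ((size N)%:R * bad_bound C m ^+ 2)%:E).
  apply: prob_bigcup_seq_le => // u uN.
  rewrite preimage_setI.
  rewrite (empty_sigma_indep xi_poisson _ (@bad_local _ _) (@bad_local _ _)).
  - by rewrite expr2 EFinM; apply: lee_pmul.
  - apply/seteqP; split=> // x [[x1 _] [x2 _]].
    have /seteqP[sub _] := box_disjoint w m uN.
    exact: sub x.1 (conj x1 x2).
by rewrite lee_fin ler_wpM2r // sqr_ge0.
Qed.

End Recursion.
End BadProbability.

(** * Solving the recursion *)

Section BadBound.
Variables (R : realType) (mu : probability (trajectory R) R) (r0 C : R).
Hypothesis C_ge0 : 0 <= C.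
Hypothesis fast_bound_small : forall m, C * fast_bound mu r0 m <= 1 / 4.
Local Notation f := (fast_bound mu r0).
Local Notation b := (bad_bound mu r0 C).

Lemma fast_bound_ge0 m : 0 <= f m.
Proof.
apply: mulr_ge0; last exact/fine_ge0/measure_ge0.
by apply: mulr_ge0; [exact: ler0n|exact: sqr_ge0].
Qed.

Lemma bad_bound_ge0 m : 0 <= b m.
Proof.
by case: m => //= m; rewrite addr_ge0 ?fast_bound_ge0 // mulr_ge0 // sqr_ge0.
Qed.

Lemma bad_bound_small m : C * b m <= 1 / 2.
Proof.
elim: m => [|m IH] /=; first by rewrite mulr0; lra.
have := fast_bound_small m; have := bad_bound_ge0 m.
have : 0 <= C * b m by rewrite mulr_ge0 // bad_bound_ge0.
by nra.
Qed.

(** As [C * b K <= 1 / 2], the recursion gives [b K.+1 <= b K / 2 + f K]; the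
    term [2 * b K] makes the resulting estimate inductive. *)
Lemma bad_bound_sum (K : nat) :
  \sum_(m < K) b m + 2 * b K <= 2 * \sum_(m < K) f m.
Proof.
elim: K => [|K IH]; first by rewrite !big_ord0 /= !mulr0 addr0.
rewrite !big_ord_recr /=.
have := bad_bound_small K; have := bad_bound_ge0 K; move: IH.
rewrite expr2 (mulrA C) => IH b_ge0 Cb.
have : C * b K * b K <= 1 / 2 * b K by rewrite ler_wpM2r.
lra.
Qed.

End BadBound.

(** * From the bad event to the count of clean points *)

Section Counting.
Variable R : realType.

Lemma shell_between (r0 v : R) m : 0 < r0 -> rad r0 m < v ->
  exists2 j, (m <= j)%N & rad r0 j < v <= rad r0 j.+1.
Proof.
move=> r0_gt0 mv.
have [k vk] : exists k, v <= rad r0 (m + k).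
  exists (Num.bound (v / r0)); set k := Num.bound _.
  have v_gt0 : 0 < v by apply: lt_trans mv; exact: rad_gt0.
  have : v / r0 <= k%:R.
    by apply: ltW; apply: archi_boundP; rewrite divr_ge0 ?ltW.
  rewrite ler_pdivrMr // mulrC => /le_trans; apply.
  rewrite /rad ler_pM2l // /rho -natrX ler_nat.
  by rewrite ltnW // (leq_trans (ltn_expl k (isT : (1 < 100)%N))) //
    leq_exp2l // leq_addl.
elim: k vk => [|k IH] vk.
  by move: (lt_le_trans mv vk); rewrite addn0 ltxx.
have [/IH//|kv] := leP v (rad r0 (m + k)).
by exists (m + k)%N; rewrite ?leq_addr // kv -addnS.
Qed.

Lemma counting_fset (T : choiceType) (W : {fset T}) :
  counting [set` W] = (#|` W|%:R)%:E :> \bar R.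
Proof. by rewrite /counting asboolT // set_fsetK. Qed.

Lemma clean_count_ge V0 (S : config R) n gamma (W : {fset plane R}) :
  [set` W] `<=` gamma @` `[0, 1] -> [set` W] `<=` ~` pollution V0 S ->
  separated_points V0 n [set` W] ->
  ((#|` W|%:R)%:E <= clean_count V0 S n gamma)%E.
Proof.
by move=> Wg Wp Ws; apply: ereal_sup_ubound; exists [set` W] => //;
  exact: counting_fset.
Qed.

Section Crossing.
Variables (V0 : R) (k0 : nat) (N1 N2 N3 : {fset plane R}) (S : config R).
Hypothesis N1_net : circle_net 1 N1.
Hypothesis N2_net : circle_net 2 N2.
Hypothesis N3_net : circle_net 3 N3.
Hypothesis V0_gt0 : 0 < V0.
Hypothesis r0_lt_V0 : rho R ^+ k0 < V0 + 1.
Hypothesis V0_width : 6 * (V0 + 1) < rho R ^+ k0 * (rho R - 1).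
Local Notation r := (rad (rho R ^+ k0)).

(** A polluting disk that is too large to be counted at scale [m] has its radius
    between two consecutive scales [j] and [j.+1] with [j >= m]; if it met the
    annulus, its centre would be within [2 * rad r0 j.+1] of the origin. *)
Lemma min_clean_count_ge m :
  ~ bad (net_pairs N1 N2 N3) (rho R ^+ k0) m 0 S ->
  (forall j, (m <= j)%N -> ~ fast_atom_in 0 (2 * r j.+1) (r j) S) ->
  (((2 ^ m)%:R)%:E <= min_clean_count V0 S (k0 + m).+1)%E.
Proof.
move=> nbad nfast; have r0_gt0 : 0 < rho R ^+ k0 by rewrite exprn_gt0 // ltr0n.
have rm : rho R ^+ (k0 + m) = r m by rewrite exprD.
have rmS : rho R ^+ (k0 + m).+1 = r m.+1 by rewrite -addnS exprD.
have D_gt0 : 0 < 3 * (V0 + 1) by move: V0_gt0; lra.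
apply: le_ereal_inf_tmp => _ [gamma [cg g0 g1 g_ann] <-].
have [||W [W_card W_spread W_pts]] := clean_crossing_all N1_net N2_net N3_net
  r0_gt0 V0_gt0 r0_lt_V0 V0_width ler01 cg nbad.
- by move: g0; rewrite /circle /= rm => ->.
- by move: g1; rewrite /circle /= rmS => ->.
have W_norm x : x \in W ->
    r m + 3 * (V0 + 1) <= enorm x <= r m.+1 - 3 * (V0 + 1).
  by move=> /W_pts[_ _]; rewrite subr0.
apply: (@le_trans _ _ (#|` W|%:R)%:E); first by rewrite lee_fin ler_nat.
apply: clean_count_ge.
- by move=> x /W_pts[].
- move=> x xW [p [Sp V0p] px].
  have [_ clean _] := W_pts _ xW; have /andP[_ x_le] := W_norm _ xW.
  have [slow_p|fast_p] := leP (speed_plus p.2) (r m).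
    exact: clean slow_p px.
  have [j mj /andP[jp pj]] := shell_between r0_gt0 fast_p.
  apply: (nfast j mj); exists p => //; split => //.
  have r_le : r m.+1 <= r j.+1.
    by rewrite /rad ler_pM2l // ler_eXn2l // /rho ?ltr1n.
  have p_le : enorm p.1 <= 2 * r j.+1.
    have := ler_enormD (p.1 - x) x; rewrite subrK enorm_distC.
    by move: px; rewrite /disk /=; lra.
  have := norm_fst_le_enorm p.1; have := norm_snd_le_enorm p.1.
  rewrite !ler_norml => /andP[? ?] /andP[? ?].
  by split; rewrite /= in_itv /=; apply/andP; split; lra.
- split.
  + move=> x /W_norm xW; rewrite /annulus rmS /= rm /disk /open_disk /= subr0.
    by split; [lra|apply/negP; rewrite -leNgt; lra].
  + exact: W_spread.
  + move=> x z /W_norm xW; rewrite /= rm rmS /circle /= !subr0.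
    have := ler_enormD (x - z) z; have := ler_enormD (z - x) x.
    by rewrite !subrK (enorm_distC z) => ? ? [zE|zE]; lra.
Qed.

End Crossing.
End Counting.

Lemma level_index (n k0 K : nat) : (k0 + (K + k0.+1) < n)%N ->
  exists2 m, n = (k0 + m).+1 & (K <= m)%N /\ (k0 < m)%N.
Proof. by move=> n_gt; exists (n - k0.+1)%N; [|split]; lia. Qed.

(** [(4 / 3) ^ 2 = 16 / 9 <= 2]. *)
Lemma four_thirds_le (R : realType) (k m : nat) : (k < m)%N ->
  (4 / 3 : R) ^+ (k + m).+1 <= 2 ^+ m.
Proof.
move=> km; apply: (@le_trans _ _ ((4 / 3) ^+ (2 * m))).
  by apply: ler_weXn2l; [lra|lia].
by rewrite exprM lerXn2r ?nnegrE //; lra.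
Qed.

Section NetPairs.
Variables (R : realType) (N1 N2 N3 : {fset plane R}).

Lemma net_pairs_apart : circle_net 1 N1 -> circle_net 2 N2 ->
  circle_net 3 N3 -> forall u, u \in net_pairs N1 N2 N3 ->
  [/\ enorm u.1 <= 60, enorm u.2 <= 60 & 20 <= enorm u.2 - enorm u.1].
Proof.
move=> [c1 _] [c2 _] [c3 _] u.
have norm i (Ni : {fset plane R}) : [set` Ni] `<=` circle 0 (20 * i%:R) ->
    forall a, a \in Ni -> enorm a = 20 * i%:R.
  by move=> ci a /ci; rewrite /circle /= subr0.
rewrite !mem_cat => /or3P[] /allpairsP[[a b] /= [aN bN ->]] /=.
- by rewrite (norm _ _ c1 _ aN) (norm _ _ c2 _ bN); split; lra.
- by rewrite (norm _ _ c1 _ aN) (norm _ _ c3 _ bN); split; lra.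
- by rewrite (norm _ _ c2 _ aN) (norm _ _ c3 _ bN); split; lra.
Qed.

Lemma size_net_pairs_le :
  (size (net_pairs N1 N2 N3))%:R <= net_constant N1 N2 N3.
Proof. by rewrite !size_cat !size_allpairs addnA le_max lexx. Qed.

(** The left side is the area of the box of [bad], in units of the squared
    speed threshold. *)
Lemma net_constant_ge : 4 * 6200 ^+ 2 <= net_constant N1 N2 N3.
Proof.
rewrite /net_constant le_max; apply/orP; right.
have := pi_ge2 R; rewrite /rho; nra.
Qed.

End NetPairs.

(** * The threshold on the speed and the conclusion *)

Section Threshold.
Variables (R : realType) (mu : probability (trajectory R) R) (C V0 : R).
Hypothesis V0_gt0 : 0 < V0.
Hypothesis C_ge : 4 * 6200 ^+ 2 <= C.

(** The exponent [n0 - 1] is nonnegative: otherwise [rho ^ (n0 - 1) <= 1 / 100],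
    too small for the width condition since [V0 + 1 > 1]. *)
Lemma speed_threshold_nat : speed_threshold mu C V0 ->
  exists k0 : nat, [/\ rho R ^+ k0 < V0 + 1,
    6 * (V0 + 1) < rho R ^+ k0 * (rho R - 1) &
    forall m, C * fast_bound mu (rho R ^+ k0) m <= 1 / 4].
Proof.
move=> [n0 []]; have -> : n0 - 2 = (n0 - 1) - 1 by lia.
case: (n0 - 1) => [k0|k] lt_V0 width small; last first.
  exfalso; move: width; rewrite NegzE -exprnN.
  have : rho R ^- k.+1 <= 100^-1.
    rewrite lef_pV2 ?posrE ?exprn_gt0 ?ltr0n // exprS ler_peMr ?ler0n //.
    by rewrite exprn_ege1 // ler1n.
  by rewrite /rho; move: V0_gt0; lra.
exists k0; split => // m.
have r0_gt0 : 0 < rho R ^+ k0 by rewrite exprn_gt0 // ltr0n.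
have C_gt0 : 0 < C by move: C_ge; lra.
(* One factor [C] comes from the recursion, the other from comparing
   [fast_bound] with the tail moment. *)
have tail_le : C ^+ 2 * tail_moment mu (rho R ^+ k0) m <= 1 / 4.
  rewrite -lee_fin EFinM; apply: le_trans small.
  apply: lee_wpmul2l; first by rewrite lee_fin sqr_ge0.
  apply: tail_moment_le_integral => //.
  rewrite expfzDr; last by rewrite /rho.
  rewrite -exprnP exprN1 /rad ler_pM2l //.
  apply: (@le_trans _ _ 1); first by rewrite invf_le1 ?ltr0n // ler1n.
  by rewrite exprn_ege1 // ler1n.
apply: le_trans tail_le; rewrite expr2 -mulrA ler_pM2l // fast_boundE.
by rewrite ler_wpM2r // tail_moment_ge0.
Qed.

End Threshold.

Theorem proposition25 (R : realType) (mu : probability (trajectory R) R)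
  (d : measure_display) (Omega : measurableType d) (P : probability Omega R)
  (xi : {RV P >-> config R})
  (xi_poisson :
    poisson_process ((lebesgue_measure \x lebesgue_measure) \x mu)%E xi)
  (mu_tempered : tempered xi)
  (mu_loop : forall alpha : R, 0 < alpha -> loop_property xi alpha)
  (mu_moment2 : (\int[mu]_h ((speed h) ^+ 2)%:E < +oo)%E)
  (L1 : set (config R)) (r1 : R) (L1_loop : loop_witness xi 1 L1 r1)
  (N1 N2 N3 : {fset plane R})
  (N1_net : circle_net 1 N1) (N2_net : circle_net 2 N2)
  (N3_net : circle_net 3 N3)
  (V0 : R) (V0_gt0 : 0 < V0)
  (V0_obstacle : (0 < P [set w | low_speed_obstacle L1 V0 0%R (xi w)])%E)
  (V0_threshold : speed_threshold mu (net_constant N1 N2 N3) V0) :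
  {ae P, forall w, \forall n \near \oo,
    (((4 / 3) ^+ n)%:E <= min_clean_count V0 (xi w) n)%E}.
Proof.
set C := net_constant N1 N2 N3 in V0_threshold *.
have C_ge : 4 * 6200 ^+ 2 <= C by exact: net_constant_ge.
have C_ge0 : 0 <= C by move: C_ge; lra.
have [k0 [lt_V0 width small]] := speed_threshold_nat V0_gt0 C_ge V0_threshold.
pose r0 := rho R ^+ k0.
have r0_gt0 : 0 < r0 by rewrite exprn_gt0 // ltr0n.
pose N := net_pairs N1 N2 N3.
have N_apart := net_pairs_apart N1_net N2_net N3_net.
pose far_fast m := fast_atom_in (0 : plane R) (2 * rad r0 m.+1)
  (rad r0 m).
pose F m := xi @^-1` bad N r0 m 0 `|` xi @^-1` far_fast m.
have mbad m : measurable (xi @^-1` bad N r0 m 0) by exact: measurable_bad.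
have mfast m : measurable (xi @^-1` far_fast m).
  rewrite fast_atom_nonempty; apply: measurableC; apply: measurable_empty_on.
  exact: measurable_fast_marks.
have mF m : measurable (F m) by exact: measurableU.
(* The constant is [4 * (2 * 100) ^+ 2]: the atoms of [far_fast m] lie in a
   box of half-width [2 * rad r0 m.+1 = 2 * 100 * rad r0 m]. *)
pose bound m := bad_bound mu r0 C m + 400 ^+ 2 * tail_moment mu r0 m.
have PF m : (P (F m) <= (bound m)%:E)%E.
  apply: le_trans (measureU2 _ (mbad m) (mfast m)) _.
  rewrite EFinD; apply: leeD.
    by apply: prob_bad_le => //; exact: size_net_pairs_le.
  have rS_gt0 := rad_gt0 m.+1 r0_gt0.
  apply: le_trans (prob_fast_atom_le xi_poisson _ _ _) _; first by lra.
  rewrite lee_fin /tail_moment radS le_eqVlt; apply/orP; left.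
  by apply/eqP; ring.
have [B B_sum] := tail_moment_summable r0_gt0 mu_moment2.
have F_sum : (\sum_(0 <= m <oo) P (F m) < +oo)%E.
  apply: (@le_lt_trans _ _ (2 * (4 * 6200 ^+ 2 * B) + 400 ^+ 2 * B)%:E);
    last exact: ltry.
  apply: lime_le; first exact: is_cvg_nneseries.
  apply: nearW => K; rewrite big_mkord.
  apply: (@le_trans _ _ (\sum_(m < K) (bound m)%:E)%E); first exact: lee_sum.
  rewrite sumEFin lee_fin big_split /= -mulr_sumr; apply: lerD.
    have := bad_bound_sum C_ge0 small K.
    have := bad_bound_ge0 mu r0 C_ge0 K.
    have -> : \sum_(m < K) fast_bound mu r0 m =
        4 * 6200 ^+ 2 * \sum_(m < K) tail_moment mu r0 m.
      by rewrite mulr_sumr; apply: eq_bigr => m _; exact: fast_boundE.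
    have := B_sum K; lra.
  by apply: ler_wpM2l; [exact: sqr_ge0|exact: B_sum].
have F_lim := lim_sup_set_cvg0 mF F_sum.
exists (lim_sup_set F); split => //.
  apply: bigcapT_measurable => n.
  by apply: bigcup_measurable => j _.
move=> w; apply: contra_notP => nlim.
have [K nF] : exists K, forall j, (K <= j)%N -> ~ F j w.
  apply: contrapT => nK; apply: nlim => K _; apply: contrapT => nj.
  by apply: nK; exists K => j Kj Fj; apply: nj; exists j.
near=> n.
have [m nE [Km km]] : exists2 m, n = (k0 + m).+1 & (K <= m)%N /\ (k0 < m)%N.
  by apply: level_index; near: n; exact: nbhs_infty_gt.
have nbad : ~ bad N r0 m 0 (xi w) by move=> bw; apply: (nF m Km); left.
have nfast j : (m <= j)%N -> ~ far_fast j (xi w).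
  by move=> mj fw; apply: (nF j (leq_trans Km mj)); right.
rewrite nE; apply: le_trans (min_clean_count_ge N1_net N2_net N3_net V0_gt0
  lt_V0 width nbad nfast).
by rewrite lee_fin natrX; exact: four_thirds_le.
Unshelve. all: by end_near.
Qed.
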